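(* Let $G=(V,E)$ be a finite simple connected graph and let $F\subseteq E$ be a forest in $G$. Let $\mathcal{T}[F]=\{T\in\mathcal{T}(G):T\supseteq F\}$. Then the induced subgraph $\mathbb{T}[\mathcal{T}[F]]$ of the spanning tree state graph $\mathbb{T}=\mathbb{T}(G)$ is connected.
   Context: A spanning tree of $G$ is a set $T\subseteq E$ such that $(V,T)$ is connected and acyclic; $\mathcal{T}(G)$ is the set of spanning trees. The spanning tree state graph $\mathbb{T}(G)$ is the graph with node set $\mathcal{T}(G)$ in which two distinct spanning trees $S,T$ are adjacent, written $S\sim T$, iff they differ by a single edge exchange, i.e. $S=(T\cup\{f\})\setminus\{e\}$ for some $f\in E\setminus T$ and $e\in T$. A forest is an acyclic set of edges. *)

(* Defs.v *)
From mathcomp Require Import all_boot.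

Set Implicit Arguments.
Unset Strict Implicit.
Unset Printing Implicit Defensive.

(* Finite simple graphs. *)
Record sgraph := SGraph {
  svertex :> finType;
  sedge : rel svertex;
  sedge_sym : symmetric sedge;
  sedge_irrefl : irreflexive sedge }.

(* An edge is the two-element set of its endpoints. *)
Definition edges (G : sgraph) : {set {set G}} :=
  [set e : {set G} | [exists x : G, exists y : G,
                        sedge x y && (e == [set x; y])]].

(* The graph with no vertices does not count as connected. *)
Definition connected (G : sgraph) : bool :=
  (0 < #|G|) && [forall x : G, forall y : G, connect (@sedge G) x y].

(* A cycle is a duplicate-free cyclic sequence of at least 3 vertices; such a
   sequence has at most #|G| entries, which makes the property decidable
   (see [acyclicP]). *)
Definition acyclic (G : sgraph) : bool :=
  [forall n : 'I_(#|G|.+1), forall c : n.-tuple G,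
     (2 < n) ==> ~~ ucycleb (@sedge G) c].

Lemma acyclicP (G : sgraph) :
  reflect (forall c : seq G, 2 < size c -> ~ ucycle (@sedge G) c) (acyclic G).
Proof.
apply: (iffP forallP) => [acG c c_gt2 cycc | acG n].
  have ltc : size c < #|G|.+1.
    by case/andP: cycc => _ /card_uniqP <-; rewrite ltnS max_card.
  have := forallP (acG (Ordinal ltc)) (in_tuple c).
  by rewrite /= c_gt2 => /negP; apply.
by apply/forallP => c; apply/implyP => n_gt2; apply/negP/acG; rewrite size_tuple.
Qed.

Section EdgeSubgraph.
Variables (G : sgraph) (T : {set {set G}}).

Definition edge_subgraph_rel : rel G :=
  [rel x y | sedge x y && ([set x; y] \in T)].

Lemma edge_subgraph_sym : symmetric edge_subgraph_rel.
Proof. by move=> x y; rewrite /edge_subgraph_rel /= sedge_sym setUC. Qed.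

Lemma edge_subgraph_irrefl : irreflexive edge_subgraph_rel.
Proof. by move=> x; rewrite /edge_subgraph_rel /= sedge_irrefl. Qed.

(* The graph (V, T): all the vertices of G, but only the edges in T. *)
Definition edge_subgraph : sgraph :=
  SGraph edge_subgraph_sym edge_subgraph_irrefl.

Definition forest : bool := (T \subset edges G) && acyclic edge_subgraph.

Definition spanning_tree : bool :=
  [&& T \subset edges G, connected edge_subgraph & acyclic edge_subgraph].

End EdgeSubgraph.

Section Induced.
Variables (G : sgraph) (A : {set G}).

Definition induced_rel : rel {x : G | x \in A} :=
  [rel u v | sedge (val u) (val v)].

Lemma induced_sym : symmetric induced_rel.
Proof. by move=> u v; rewrite /induced_rel /= sedge_sym. Qed.

Lemma induced_irrefl : irreflexive induced_rel.
Proof. by move=> u; rewrite /induced_rel /= sedge_irrefl. Qed.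

Definition induced : sgraph := SGraph induced_sym induced_irrefl.

End Induced.

Section StateGraph.
Variable G : sgraph.

Definition edge_exchange (S T : {set {set G}}) : bool :=
  [exists f : {set G}, exists e : {set G},
     [&& f \in edges G :\: T, e \in T & S == (f |: T) :\ e]].

Definition state_rel : rel {T : {set {set G}} | spanning_tree T} :=
  [rel S T | (S != T) && edge_exchange (val S) (val T)].

Lemma state_sym : symmetric state_rel.
Proof.
suff imp S T : state_rel S T -> state_rel T S.
  by move=> S T; apply/idP/idP; apply: imp.
case/andP=> neqST /existsP[f /existsP[e /and3P[]]].
rewrite inE => /andP[fNT fE] eT /eqP defS.
have neq_fe : f != e by apply: contraNneq fNT => ->.
apply/andP; split; first by rewrite eq_sym.
apply/existsP; exists e; apply/existsP; exists f; apply/and3P; split.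
- rewrite inE defS !inE eqxx /=.
  by have /and3P[sTE _ _] := valP T; have := subsetP sTE e eT; rewrite inE.
- by rewrite defS !inE neq_fe eqxx.
apply/eqP/setP=> g; rewrite defS !inE.
have [-> | _] := eqVneq g f; first by rewrite (negPf fNT).
by have [-> | _] := eqVneq g e; rewrite ?eT.
Qed.

Lemma state_irrefl : irreflexive state_rel.
Proof. by move=> S; rewrite /state_rel /= eqxx. Qed.

(* The spanning tree state graph; its vertex type is the type of spanning
   trees of G. *)
Definition state_graph : sgraph := SGraph state_sym state_irrefl.

Definition trees_containing (F : {set {set G}}) : {set state_graph} :=
  [set T : state_graph | F \subset val T].

End StateGraph.

(* Main.v *)
Require Import Defs.
From mathcomp Require Import all_boot.

(** The spanning trees of a connected graph are the bases of its cycle matroid,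
    and the trees containing [F] are those of the contraction by [F]; the claim
    is the connectedness of the basis exchange graph of a matroid.

    The closure operator of this matroid sends a set [T] of edges to the pairs
    of vertices that are joined by a walk in [T]. Two facts about it carry the
    proof. A set of edges is acyclic iff no edge lies in the closure of the
    others ([acyclic_bridgeP]), and the closure has the Steinitz exchange
    property ([conn_exchange]): if adding [xy] to [T] joins the previously
    separated vertices [a] and [b], then adding [ab] to [T] joins [x] and [y].

    It follows that an acyclic set remains acyclic when an edge between two of
    its components is added ([acyclic_add]). A maximal acyclic set of edges
    containing [F] is therefore a spanning tree, so some tree contains [F].

    Moreover, if [e] is in the tree [S] but not in the tree [T], then [T] has an
    edge [f] joining the two components of [S] minus [e], and exchanging [e] for
    [f] yields a tree with fewer edges outside [T] ([tree_exchange]). If [T]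
    contains [F] then [e] is not in [F], so that the new tree contains [F] as
    soon as [S] does. Iterating leads from [S] to [T] through trees that
    contain [F]. *)

Set Implicit Arguments.
Unset Strict Implicit.
Unset Printing Implicit Defensive.

Lemma connect_crossing (V : finType) (e : rel V) (P : pred V) (a b : V) :
  connect e a b -> P a -> ~~ P b -> exists u w, [/\ e u w, P u & ~~ P w].
Proof.
case/connectP=> p pth ->; elim: p a pth => [|z p IHp] a /=; first by move=> _ ->.
case/andP=> eaz pth Pa; have [Pz | nPz _] := boolP (P z); first exact: IHp.
by exists a, z.
Qed.

Section EdgeSets.
Variable G : sgraph.
Implicit Types (S T F : {set {set G}}) (x y a b : G).

Definition conn T : rel G := connect (edge_subgraph_rel T).

Lemma conn_sym T : symmetric (conn T).
Proof. exact/sym_connect_sym/edge_subgraph_sym. Qed.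

Lemma edge_rel_sub S T :
  S \subset T -> subrel (edge_subgraph_rel S) (edge_subgraph_rel T).
Proof. by move=> /subsetP sST x y /andP[xy /sST xyT]; apply/andP. Qed.

Lemma conn_sub S T : S \subset T -> subrel (conn S) (conn T).
Proof.
by move=> sST; apply: connect_sub => x y /(edge_rel_sub sST); apply: connect1.
Qed.

Lemma conn_ends T x y a b : [set a; b] = [set x; y] -> conn T x y -> conn T a b.
Proof.
move=> defab cxy.
have : a \in [set x; y] by rewrite -defab set21.
have : b \in [set x; y] by rewrite -defab set22.
rewrite !inE => /orP[] /eqP -> /orP[] /eqP -> //; try exact: connect0.
by rewrite conn_sym.
Qed.

Lemma edgesP (e : {set G}) :
  reflect (exists x y, sedge x y /\ e = [set x; y]) (e \in edges G).
Proof.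
rewrite inE; apply: (iffP existsP) => [[x /existsP[y /andP[xy /eqP ->]]]|].
  by exists x, y.
by case=> x [y [xy ->]]; exists x; apply/existsP; exists y; rewrite xy eqxx.
Qed.

(** A cycle through [xy] is the same thing as [xy] together with a simple path
    between its ends that avoids it. *)
Lemma acyclic_bridgeP T :
  reflect (forall x y, edge_subgraph_rel T x y -> ~~ conn (T :\ [set x; y]) x y)
          (acyclic (edge_subgraph T)).
Proof.
apply: (iffP (acyclicP _)) => [acT x y xy | bridge c].
  apply/negP => /connectP[p0 /shortenP[p pth up _] defy].
  apply: (acT (x :: p)).
    case: p pth defy {up} => [|z [|//]] /=.
      by move=> _ defy; rewrite defy edge_subgraph_irrefl in xy.
    by rewrite andbT => + defy; rewrite defy /edge_subgraph_rel /= setD11 andbF.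
  rewrite /ucycle up andbT /= rcons_path (sub_path (edge_rel_sub (subsetDl _ _)) pth).
  by rewrite -defy edge_subgraph_sym.
case: c => [|x [|y q]] // q_gt0 /andP[].
rewrite /= rcons_path => /and3P[xy pth lx] /andP[xNyq /andP[yNq _]].
have lq : last y q \in q by case: q q_gt0 {pth lx xNyq yNq} => //= z q _; apply: mem_last.
have ly : last y q != y by apply: contraNneq yNq => <-.
apply/negP: (bridge x y xy); rewrite negbK conn_sym.
apply: (@connect_trans _ _ (last y q)).
  apply/connectP; exists q => //.
  (* As x does not occur in y :: q, the edges of this path are not [set x; y]. *)
  apply: (sub_in_path (P := predC1 x) _ _ pth).
    move=> u w /= ux wx /andP[/= ruw uw]; apply/andP; split=> //.
    rewrite /= !inE uw andbT.
    apply: contraNneq ux => defuw.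
    have : x \in [set u; w] by rewrite defuw set21.
    by rewrite !inE (eq_sym x w) (negPf wx) orbF eq_sym.
  by apply/allP => u uyq /=; apply: contraNneq xNyq => <-.
apply: connect1; move: lx => /andP[/= lx lT]; apply/andP; split=> //=.
rewrite !inE lT andbT; apply: contraNneq ly => deflx.
have : last y q \in [set x; y] by rewrite -deflx set21.
by rewrite !inE => /orP[/eqP lqx|//]; rewrite lqx sedge_irrefl in lx.
Qed.

Lemma acyclic_sub S T :
  S \subset T -> acyclic (edge_subgraph T) -> acyclic (edge_subgraph S).
Proof.
move=> sST /acyclic_bridgeP acT; apply/acyclic_bridgeP => x y xy.
apply: contra (acT x y (edge_rel_sub sST xy)); apply: conn_sub.
exact: setSD.
Qed.

(** A walk from [a] to [b] in [xy |: T] must leave the [T]-component of [a] and,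
    read backwards, that of [b]. Both times it does so along [xy], so that the
    ends of [xy] lie in these two components, which [ab] joins. *)
Lemma conn_exchange T x y a b :
    sedge a b -> conn ([set x; y] |: T) a b -> ~~ conn T a b ->
  conn ([set a; b] |: T) x y.
Proof.
move=> ab cab ncab.
have leave c d : conn ([set x; y] |: T) c d -> ~~ conn T c d ->
    exists u w, [set u; w] = [set x; y] /\ conn T c u.
  move=> ccd ncd.
  have [u [w [/andP[/= uw uwT] cu ncw]]] :=
    connect_crossing ccd (connect0 _ c : conn T c c) ncd.
  exists u, w; split=> //; move: uwT; rewrite !inE => /orP[/eqP //|uwT].
  case/negP: ncw; apply: connect_trans cu (connect1 _).
  by rewrite /edge_subgraph_rel /= uw.
have [u [w [defuw cau]]] := leave a b cab ncab.
have [|| u' [w' [defuw' cbu']]] := leave b a; try by rewrite conn_sym.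
have defw : u' = w.
  have : u' \in [set u; w] by rewrite defuw -defuw' set21.
  rewrite !inE => /orP[] /eqP // defu'; case/negP: ncab.
  by apply: connect_trans cau _; rewrite -/(conn T u b) conn_sym -defu'.
set U := _ |: T; have sTU : T \subset U := subsetUr _ _.
have cuw : conn U u w.
  apply: (@connect_trans _ _ a); first by rewrite -/(conn U u a) conn_sym (conn_sub sTU).
  apply: (@connect_trans _ _ b); last by rewrite -defw; apply: conn_sub sTU _ _ cbu'.
  by apply: connect1; rewrite /edge_subgraph_rel /= ab setU11.
exact: conn_ends (esym defuw) cuw.
Qed.

(** If an old edge [ab] ceased to be a bridge, then [xy] would join [a] and [b]
    in the absence of [ab], and by exchange [ab] would already join [x] and [y]. *)
Lemma acyclic_add T x y :
    acyclic (edge_subgraph T) -> ~~ conn T x y ->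
  acyclic (edge_subgraph ([set x; y] |: T)).
Proof.
move=> /acyclic_bridgeP acT ncxy; apply/acyclic_bridgeP => a b /andP[/= ab].
have [defab _ | neq] := eqVneq [set a; b] [set x; y].
  have sub : ([set x; y] |: T) :\ [set a; b] \subset T.
    by rewrite defab setDUl setDv set0U subsetDl.
  by apply: contra ncxy => /(conn_sub sub); apply: conn_ends.
rewrite in_setU1 (negPf neq) /= => abT.
have defD : ([set x; y] |: T) :\ [set a; b] = [set x; y] |: (T :\ [set a; b]).
  apply/setP=> g; rewrite !inE; have [-> | //] := eqVneq g [set x; y].
  by rewrite eq_sym neq.
rewrite defD; apply: contra ncxy => cab.
have rab : edge_subgraph_rel T a b by rewrite /edge_subgraph_rel /= ab.
by rewrite -(setD1K abT); apply: conn_exchange ab cab (acT a b rab).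
Qed.

Lemma connected_connE T : connected (edge_subgraph T) -> forall x y, conn T x y.
Proof. by case/andP=> _ /forallP cT x y; have /forallP := cT x; apply. Qed.

Lemma conn_connected T :
  0 < #|G| -> (forall x y, conn T x y) -> connected (edge_subgraph T).
Proof.
by move=> G_gt0 cT; apply/andP; split=> //; apply/'forall_forallP; exact: cT.
Qed.

Lemma forest_extends F :
  connected G -> forest F -> exists2 T, spanning_tree T & F \subset T.
Proof.
move=> /andP[G_gt0 /forallP cG] foF.
have [T /maxsetP[/andP[sTE acT] maxT] sFT] := maxset_exists foF.
exists T => //; apply/and3P; split=> //.
apply: conn_connected => // x y.
apply: (connect_sub _ (forallP (cG x) y)) => {}x {}y xy.
apply/negPn/negP => ncxy; case/negP: (ncxy).
have defT : [set x; y] |: T = T.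
  apply: maxT (subsetUr _ _); apply/andP; split; last exact: acyclic_add.
  by rewrite subUset sTE andbT sub1set; apply/edgesP; exists x, y.
by apply: connect1; rewrite /edge_subgraph_rel /= xy -defT setU11.
Qed.

(** The edge [f] is one at which [T] leaves a component of [S :\ e]. *)
Lemma tree_exchange S T (e : {set G}) :
    spanning_tree S -> spanning_tree T -> e \in S :\: T ->
  exists2 f, f \in T :\: S & spanning_tree ((f |: S) :\ e).
Proof.
case/and3P=> sSE cS acS /and3P[sTE cT _]; rewrite inE => /andP[eNT eS].
have /edgesP[x [y [xy defe]]] := subsetP sSE e eS; rewrite defe in eNT eS *.
have ncxy : ~~ conn (S :\ [set x; y]) x y.
  by apply: (acyclic_bridgeP _ acS); rewrite /edge_subgraph_rel /= xy.
have [a [b [/andP[/= ab abT] cxa ncxb]]] :=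
  connect_crossing (connected_connE cT x y)
    (connect0 _ x : conn (S :\ [set x; y]) x x) ncxy.
have ncab : ~~ conn (S :\ [set x; y]) a b.
  by apply: contra ncxb; apply: connect_trans.
have neq : [set a; b] != [set x; y] by apply: contraNneq eNT => <-.
exists [set a; b].
  rewrite inE abT andbT; apply: contra ncab => abS.
  by apply: connect1; rewrite /edge_subgraph_rel /= ab !inE neq.
have -> : ([set a; b] |: S) :\ [set x; y] = [set a; b] |: (S :\ [set x; y]).
  apply/setP=> g; rewrite !inE; have [-> | //] := eqVneq g [set a; b].
  by rewrite neq.
have cxy : conn ([set a; b] |: (S :\ [set x; y])) x y.
  by apply: conn_exchange ncab => //; rewrite setD1K //; apply: connected_connE.
apply/and3P; split.
- rewrite subUset sub1set (subsetP sTE _ abT) /=.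
  exact: subset_trans (subsetDl _ _) sSE.
- case/andP: cS (connected_connE cS) => G_gt0 _ cS.
  apply: conn_connected => // u w.
  apply: (connect_sub _ (cS u w)) => {}u {}w /andP[/= uw uwS].
  have [defuw | nuw] := eqVneq [set u; w] [set x; y].
    exact: conn_ends defuw cxy.
  by apply: connect1; rewrite /edge_subgraph_rel /= uw !inE nuw uwS orbT.
- exact: acyclic_add (acyclic_sub (subsetDl _ _) acS) ncab.
Qed.

(** An edge of [T] outside [S] could only be exchanged for an edge of [S]
    outside [T]. *)
Lemma tree_sub_eq S T :
  spanning_tree S -> spanning_tree T -> S \subset T -> S = T.
Proof.
move=> trS trT sST; apply/eqP; rewrite eqEsubset sST /=.
apply/subsetP=> e eT; apply/negPn/negP => eNS.
have [|f] := tree_exchange (e := e) trT trS; first by rewrite inE eNS.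
by rewrite inE => /andP[/negP fNT /(subsetP sST)].
Qed.

End EdgeSets.

Theorem proposition1p2 (G : sgraph) (F : {set {set G}}) :
  connected G -> forest F -> connected (induced (trees_containing F)).
Proof.
move=> cG foF; apply/andP; split.
  have [T trT sFT] := forest_extends cG foF.
  have TF : (Sub T trT : state_graph G) \in trees_containing F by rewrite inE.
  by apply/card_gt0P; exists (exist (fun U => U \in trees_containing F) _ TF).
apply/'forall_forallP => S T.
have [n] := ubnP #|val (val S) :\: val (val T)|.
elim: n S => // n IHn S; rewrite ltnS => leSn.
have trS := valP (val S); have trT := valP (val T).
have sFS : F \subset val (val S) by have := valP S; rewrite inE.
have sFT : F \subset val (val T) by have := valP T; rewrite inE.
have [/eqP | [e eST]] := set_0Vmem (val (val S) :\: val (val T)).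
  rewrite setD_eq0 => /(tree_sub_eq trS trT) /val_inj /val_inj ->.
  exact: connect0.
have [f fTS trS'] := tree_exchange trS trT eST.
move: (eST) (fTS); rewrite !inE => /andP[eNT eS] /andP[fNS fT].
have fe : f != e by apply: contraNneq eNT => <-.
pose S1 : state_graph G := Sub _ trS'.
have S1F : S1 \in trees_containing F.
  rewrite inE /=; apply/subsetP => g gF; rewrite !inE (subsetP sFS) // orbT andbT.
  by apply: contraNneq eNT => <-; apply: (subsetP sFT).
pose S2 : induced (trees_containing F) :=
  exist (fun U => U \in trees_containing F) S1 S1F.
apply: (@connect_trans _ _ S2); last first.
  apply: IHn; apply: leq_trans leSn; apply: proper_card; apply/properP; split.
    apply/subsetP=> g; rewrite !inE => /and3P[gNT _ /orP[/eqP gf|->]]; last by rewrite gNT.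
    by rewrite gf fT in gNT.
  by exists e => //; rewrite !inE eqxx andbF.
apply: connect1; rewrite sedge_sym; apply/andP; split.
  by apply: contraNneq fNS => <-; rewrite /= !inE fe eqxx.
apply/existsP; exists f; apply/existsP; exists e; rewrite eS eqxx inE fNS.
by case/and3P: trT => /subsetP ->.
Qed.
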